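(* For all positive integers $m,n$, we have $$\zeta^{*}(\underbrace{2m,2m,\ldots,2m}_{n})=\left\{\sum_{\substack{n_{0}+\cdots+n_{m-1}=mn\\ n_{0},\ldots,n_{m-1}\geq 0}}(-1)^{m(n-1)}\left(\prod_{k=0}^{m-1}\frac{(2^{2n_{k}}-2)B_{2n_{k}}}{(2n_{k})!}\right)\exp\left(\frac{2\pi \sqrt{-1}}{m}\sum_{l=0}^{m-1} l\,n_{l}\right)\right\}\pi^{2mn},$$ where the outer sum runs over all $m$-tuples $(n_0,\ldots,n_{m-1})$ of nonnegative integers with sum $mn$.
   Context: For positive integers $k_1,\ldots,k_r$ with $k_1\geq 2$, the multiple zeta-star value is the convergent series $$\zeta^*(k_1,\ldots,k_r)=\sum_{m_1\geq m_2\geq\cdots\geq m_r>0}\frac{1}{m_1^{k_1}m_2^{k_2}\cdots m_r^{k_r}},$$ the sum being over positive integers $m_1,\dots,m_r$. $B_{2j}$ ($j\ge 0$) denotes the classical Bernoulli numbers, defined by $\frac{t}{e^t-1}=\sum_{j\ge0}B_j\frac{t^j}{j!}$ (so $B_0=1$, $B_2=1/6$, $B_4=-1/30$). *)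

(* Defs.v *)
From mathcomp Require Export all_boot all_order all_algebra.
From mathcomp Require Export all_classical all_reals all_analysis.
From mathcomp Require Export complex.

Set Implicit Arguments.
Unset Strict Implicit.
Unset Printing Implicit Defensive.

Export Order.TTheory GRing.Theory Num.Theory numFieldNormedType.Exports.

Local Open Scope classical_set_scope.
Local Open Scope complex_scope.
Local Open Scope ring_scope.

(* The terms are nonnegative, so the series is their unordered sum in \bar R;
   divergence is the value +oo. *)
Definition zeta_star (R : realType) (r : nat) (k : r.-tuple nat) : \bar R :=
  \esum_(m in [set m : r.-tuple nat | sorted geq m && all (leq 1) m])
    (\prod_(i < r) ((tnth m i)%:R ^+ tnth k i)^-1)%:E.

(* t / (e^t - 1) = \sum_j B_j t^j / j! for all real t != 0 near 0; this
   determines B since the coefficients of a power series are unique. *)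
Definition is_bernoulli (R : realType) (B : nat -> R) : Prop :=
  \forall t \near (0 : R)^',
    [series B j * t ^+ j / j`!%:R]_j @ \oo --> t / (expR t - 1).

Definition cexp (R : realType) (z : R[i]) : R[i] :=
  (expR (complex.Re z))%:C * (cos (complex.Im z) +i* sin (complex.Im z)).

(* Main.v *)
Require Import Defs.
From mathcomp Require Import ring lra.

Set Implicit Arguments.
Unset Strict Implicit.
Unset Printing Implicit Defensive.

Local Open Scope classical_set_scope.
Local Open Scope complex_scope.
Local Open Scope ring_scope.

(** The star value is the limit, as N grows, of the complete homogeneous sum h_n
    of the numbers 1/j^(2m) for j <= N, because a weakly decreasing tuple of
    positive integers is a monomial of degree n.  Two facts determine this limit.

    Reduction to m = 1.  The generating series of the h_n(s) is the inverse of
    P_s(X), the product of the 1 - x X for x in s.  If w is a primitive m-th root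
    of unity, the product of the P_s(w^k X) for k < m is P_(s^m)(X^m), where s^m
    consists of the m-th powers; inverting and comparing coefficients writes
    h_n(s^m) as the sum, over the tuples with n_0 + ... + n_(m-1) = m n, of the
    products of the w^(k n_k) h_(n_k)(s) (hsym_pow).  With s the 1/j^2 for j <= N
    this is a finite sum, so it passes to the limit term by term.

    The case m = 1.  The coefficients of P_s tend to those of sin(pi x)/(pi x)
    in x^2 (cvg_recip_prod_inv_squares); this coefficientwise form of Euler's
    product needs no infinite product: since x cos x <= sin x <= x, the numbers
    1/j^2 lie between multiples of cot^2 and of 1/sin^2 at the angles
    j pi/(2N+1), and de Moivre's formula gives the symmetric functions of those
    in closed form.  As P_s times the series of the h_n(s) is 1, the h_n converge
    to the coefficients of the inverse series t/sin t at t = pi x.  The latter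
    are read off the Bernoulli numbers from t/sinh t = 2 b(t) - b(2t), where
    b(t) = t/(e^t - 1) (bernoulli_conv); replacing t by i t gives the signs
    (-1)^n.

    The identity for h_n(s^m) has complex coefficients while all limits are
    limits of real sequences, so its real and imaginary parts are taken apart. *)

(** * Complete homogeneous sums and their generating series *)

(** The polynomial whose power series inverse generates the complete homogeneous
    sums; up to sign its coefficients are the elementary symmetric functions. *)
Definition recip_prod (F : nzRingType) (s : seq F) : {poly F} :=
  \prod_(x <- s) (1 - x *: 'X).

(** The complete homogeneous symmetric sum of degree n in the entries of s.  The
    recursion separates the monomials by whether they contain the first entry. *)
Fixpoint hsym (F : nzRingType) (s : seq F) : nat -> F :=
  if s is x :: s' then
    fix h n := if n is k.+1 then hsym s' n + x * h k else hsym s' 0%N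
  else fun n => (n == 0%N)%:R.

Lemma hsym0 (F : nzRingType) (s : seq F) : hsym s 0 = 1.
Proof. by elim: s. Qed.

Lemma hsymS (F : nzRingType) (x : F) s n :
  hsym (x :: s) n.+1 = hsym s n.+1 + x * hsym (x :: s) n.
Proof. by []. Qed.

Lemma hsym_map (F E : nzRingType) (g : {rmorphism F -> E}) s n :
  g (hsym s n) = hsym (map g s) n.
Proof.
elim: s n => [|x s IHs] n /=; first by rewrite rmorph_nat.
by elim: n => [|n IHn]; rewrite ?IHs // rmorphD rmorphM IHs IHn.
Qed.

(** Multiplying the generating series of x :: s by 1 - x X gives that of s; the
    truncation leaves an error at degree D only. *)
Lemma hsym_recip_prod (F : fieldType) (s : seq F) D :
  'X^D %| (\poly_(i < D) hsym s i) * recip_prod s - 1.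
Proof.
elim: s => [|x s IHs].
  rewrite /recip_prod big_nil mulr1; case: D => [|D]; first by rewrite dvd1p.
  suff -> : \poly_(i < D.+1) hsym [::] i = 1 :> {poly F} by rewrite subrr dvdp0.
  by apply/polyP => i; rewrite coef_poly coef1; case: i => [|i] //=; case: ifP.
rewrite /recip_prod big_cons mulrA -/(recip_prod s).
case: D IHs => [|D] IHs; first by rewrite dvd1p.
have -> : \poly_(i < D.+1) hsym (x :: s) i * (1 - x *: 'X) =
          \poly_(i < D.+1) hsym s i - (x * hsym (x :: s) D) *: 'X^(D.+1).
  apply/polyP => i; rewrite mulrBr mulr1 -scalerAr !coefB.
  rewrite !coefZ coefMX coefXn !coef_poly.
  case: i => [|i] /=; first by rewrite !mulr0 subr0.
  rewrite !ltnS; case: ltngtP => hi; rewrite ?hsymS ?eqSS.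
  - by rewrite (ltn_eqF hi) ?(ltnW hi) mulr0 subr0 addrK.
  - by rewrite (gtn_eqF hi) !mulr0.
  - by rewrite hi eqxx mulr1.
rewrite mulrBl addrAC dvdp_addr // dvdpNr -scalerAl.
by rewrite -mul_polyC dvdp_mull // dvdp_mulr.
Qed.

Lemma dvdp_inv_uniq (F : fieldType) (d p q r : {poly F}) :
  d %| p * r - 1 -> d %| q * r - 1 -> d %| p - q.
Proof.
move=> hp hq; have -> : p - q = (p * r - 1) * q - (q * r - 1) * p by ring.
by rewrite dvdp_sub ?dvdp_mulr.
Qed.

Lemma dvdp_prod_inv (F : fieldType) (I : finType) (d : {poly F})
    (p r : I -> {poly F}) :
  (forall k, d %| p k * r k - 1) -> d %| (\prod_k p k) * (\prod_k r k) - 1.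
Proof.
move=> h; rewrite -big_split /=; apply: (big_ind (fun x => d %| x - 1)).
- by rewrite subrr dvdp0.
- move=> x y hx hy; have -> : x * y - 1 = (x - 1) * y + (y - 1) by ring.
  by rewrite dvdp_add ?dvdp_mulr.
- by move=> k _; apply: h.
Qed.

Lemma dvd_Xn_comp_scaleX (F : fieldType) D (c : F) (p : {poly F}) :
  'X^D %| p -> 'X^D %| p \Po (c *: 'X).
Proof.
case/dvdpP => q ->; rewrite comp_polyM dvdp_mull //.
by rewrite comp_Xn_poly exprZn -mul_polyC dvdp_mull.
Qed.

Lemma coef_dvd_Xn (F : fieldType) D (p q : {poly F}) i :
  'X^D %| p - q -> (i < D)%N -> p`_i = q`_i.
Proof.
case/dvdpP => r hr hi; apply/eqP; rewrite -subr_eq0 -coefB hr.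
by rewrite coefMXn hi.
Qed.

(** The difference of the two sides has degree at most the number of the r_j, and
    vanishes at 0 and at each of them.  This one criterion yields the
    factorization of 1 - X^m and those of the trigonometric polynomials below. *)
Lemma poly_eq_recip_prod (F : fieldType) (p : {poly F}) (r : seq F) :
  (size p <= (size r).+1)%N -> p`_0 = 1 -> uniq r -> 0 \notin r ->
  all (root p) r -> p = recip_prod [seq x^-1 | x <- r].
Proof.
move=> hs h0 hu hr0 hr; apply/eqP; rewrite -subr_eq0; apply/eqP.
apply: (roots_geq_poly_eq0 (rs := 0 :: r)).
- have h00 : root (p - recip_prod [seq x^-1 | x <- r]) 0.
    rewrite /root !hornerE horner_coef0 h0 /recip_prod horner_prod.
    by rewrite big1 ?subrr // => i _; rewrite !hornerE ?mulr0 ?subr0.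
  rewrite /= h00; apply/allP => x hx.
  rewrite /root !hornerE (eqP (allP hr x hx)) /recip_prod horner_prod big_map.
  rewrite (big_rem x hx) /= !hornerE mulVf ?subrr ?mul0r ?subrr ?oppr0 //.
  by apply: contraTneq hx => ->.
- by rewrite /= hr0.
- rewrite /= (leq_trans (size_polyD _ _)) // geq_max hs size_polyN /=.
  rewrite /recip_prod big_map {hs h0 hu hr0 hr}.
  elim: r => [|x r IH]; rewrite ?big_nil ?size_poly1 // big_cons.
  rewrite (leq_trans (size_polyMleq _ _)) //.
  have h2 : (size (1 - x^-1 *: 'X : {poly F})%R <= 2)%N.
    rewrite (leq_trans (size_polyD _ _)) // geq_max size_poly1 size_polyN.
    by rewrite (leq_trans (size_scale_leq _ _)) // size_polyX.
  by rewrite -subn1 leq_subLR (leq_trans (leq_add h2 IH)).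
Qed.

Lemma recip_prod_scale (F : fieldType) (c : F) s :
  recip_prod s \Po (c *: 'X) = recip_prod [seq c * x | x <- s].
Proof.
rewrite /recip_prod big_map; elim: s => [|x s IH].
  by rewrite !big_nil comp_polyC.
rewrite !big_cons comp_polyM IH comp_polyB comp_polyC comp_polyZ comp_polyX.
by rewrite scalerA mulrC [x * c]mulrC mulrC.
Qed.

Lemma prod_unity_root (F : fieldType) m (z : F) : m.-primitive_root z ->
  \prod_(k < m) (1 - z ^+ k *: 'X) = 1 - 'X^m.
Proof.
move=> hz; have m0 := prim_order_gt0 hz.
have z0 : z != 0 by apply: contra_eq_neq (prim_expr_order hz) => ->;
  rewrite expr0n gtn_eqF // eq_sym oner_eq0.
pose r := [seq (z ^+ k)^-1 | k <- iota 0 m].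
have -> : 1 - 'X^m = recip_prod [seq x^-1 | x <- r].
  apply: poly_eq_recip_prod.
  - rewrite size_map size_iota (leq_trans (size_polyD _ _)) // geq_max.
    by rewrite size_poly1 size_polyN size_polyXn leqnn.
  - by rewrite coefB coef1 coefXn [0%N == m]ltn_eqF // subr0.
  - rewrite map_inj_in_uniq ?iota_uniq // => i j.
    rewrite !mem_iota !add0n /= => hi hj /invr_inj /eqP.
    by rewrite (eq_prim_root_expr hz) !modn_small // => /eqP.
  - apply/mapP => -[k _ /esym/eqP]; rewrite invr_eq0 expf_eq0.
    by rewrite (negPf z0) andbF.
  - apply/allP => _ /mapP[k _ ->]; rewrite /root !hornerE exprVn.
    by rewrite exprAC (prim_expr_order hz) expr1n invr1 subrr.
rewrite /recip_prod !big_map -[in RHS](subn0 m) big_mkord.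
by apply: eq_bigr => k _; rewrite invrK.
Qed.

(** For one entry x this is the factorization of 1 - Z^m at Z = x X. *)
Lemma prod_recip_prod_unity (F : fieldType) m (z : F) (s : seq F) :
  m.-primitive_root z ->
  \prod_(k < m) (recip_prod s \Po (z ^+ k *: 'X)) =
  recip_prod [seq x ^+ m | x <- s] \Po 'X^m.
Proof.
move=> hz; rewrite /recip_prod big_map rmorph_prod /=.
under eq_bigr do rewrite rmorph_prod /=.
rewrite exchange_big /=; apply: eq_bigr => x _.
have := congr1 (fun p => p \Po (x *: 'X)) (prod_unity_root hz).
rewrite rmorph_prod /= comp_polyB comp_polyC comp_Xn_poly exprZn.
rewrite comp_polyB comp_polyC comp_polyZ comp_polyX => <-.
apply: eq_bigr => k _.
by rewrite !comp_polyB !comp_polyC !comp_polyZ !comp_polyX !scalerA mulrC.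
Qed.

(** Modulo X^(m n + 1), both the product over k of the generating series of s at
    z^k X and the generating series of the m-th powers at X^m invert the same
    polynomial; the identity compares their coefficients at X^(m n). *)
Lemma hsym_pow (F : fieldType) m n (z : F) (s : seq F) :
  m.-primitive_root z ->
  hsym [seq x ^+ m | x <- s] n =
  \sum_(f : {ffun 'I_m -> 'I_(m * n).+1} |
          (\sum_(k < m) (f k : nat))%N == (m * n)%N)
     \prod_(k < m) (hsym s (f k) * (z ^+ k) ^+ f k).
Proof.
move=> hz; have m0 := prim_order_gt0 hz.
set D := (m * n).+1.
pose A k := (\poly_(i < D) hsym s i) \Po (z ^+ k *: 'X).
pose B := (\poly_(i < D) hsym [seq x ^+ m | x <- s] i) \Po 'X^m.
have hA : 'X^D %| (\prod_(k < m) A k) *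
                 (recip_prod [seq x ^+ m | x <- s] \Po 'X^m) - 1.
  rewrite -(prod_recip_prod_unity s hz); apply: dvdp_prod_inv => k.
  rewrite /A -comp_polyM -[1](comp_polyC 1 (z ^+ k *: 'X)) -comp_polyB.
  exact: dvd_Xn_comp_scaleX (hsym_recip_prod s D).
have hB : 'X^D %| B * (recip_prod [seq x ^+ m | x <- s] \Po 'X^m) - 1.
  rewrite /B -comp_polyM -[1](comp_polyC 1 ('X^m)) -comp_polyB.
  have /dvdpP[q ->] := hsym_recip_prod [seq x ^+ m | x <- s] D.
  rewrite comp_polyM dvdp_mull // comp_Xn_poly -exprM.
  by rewrite dvdp_exp2l // leq_pmull.
have := coef_dvd_Xn (dvdp_inv_uniq hA hB) (ltnSn (m * n)).
rewrite /B coef_comp_poly_Xn // dvdn_mulr // mulKn // coef_poly.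
rewrite ltnS leq_pmull // => <-.
have EA k : A k = \sum_(i < D) (hsym s i * (z ^+ k) ^+ i) *: 'X^i.
  rewrite /A poly_def rmorph_sum /=; apply: eq_bigr => i _.
  by rewrite comp_polyZ comp_Xn_poly exprZn scalerA.
under eq_bigr do rewrite EA.
rewrite bigA_distr_bigA /= coef_sum [RHS]big_mkcond /=; apply: eq_bigr => f _.
rewrite scaler_prod prodrXr coefZ coefXn eq_sym.
by case: ifP; rewrite ?mulr1 ?mulr0.
Qed.

(** The duality of elementary and complete symmetric functions. *)
Lemma sum_recip_prod_hsym (F : fieldType) (s : seq F) n :
  \sum_(i < n.+1) (recip_prod s)`_i * hsym s (n - i) = (n == 0%N)%:R.
Proof.
have := coef_dvd_Xn (hsym_recip_prod s n.+1) (ltnSn n).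
rewrite coef1 => <-; rewrite coefMr; apply: eq_bigr => i _.
by rewrite coef_poly ltnS leq_subr mulrC.
Qed.

Lemma coef_comp_scaleX (F : fieldType) (c : F) (p : {poly F}) i :
  (p \Po (c *: 'X))`_i = c ^+ i * p`_i.
Proof.
rewrite comp_polyE coef_sum.
under eq_bigr do rewrite exprZn !coefZ coefXn.
case: (ltnP i (size p)) => hi.
  rewrite (bigD1 (Ordinal hi)) //= big1 ?eqxx ?mulr1 ?addr0 1?mulrC // => j.
  by rewrite -val_eqE /= eq_sym => /negPf ->; rewrite !mulr0.
rewrite nth_default // mulr0 big1 // => j _.
by rewrite gtn_eqF ?mulr0 // (leq_trans (ltn_ord j)).
Qed.

(** Elementary symmetric functions are monotone on nonnegative arguments; this is
    what lets a bound on the entries pass to the coefficients. *)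
Lemma coef_recip_prod_le (F : numFieldType) (I : eqType) (f g : I -> F) s q :
  {in s, forall j, 0 <= f j <= g j} ->
  0 <= (-1) ^+ q * (recip_prod (map f s))`_q
    <= (-1) ^+ q * (recip_prod (map g s))`_q.
Proof.
have coefS x (p : {poly F}) i : (-1) ^+ i.+1 * ((1 - x *: 'X) * p)`_i.+1 =
    (-1) ^+ i.+1 * p`_i.+1 + x * ((-1) ^+ i * p`_i).
  by rewrite mulrBl mul1r -scalerAl coefB coefZ coefXM /= exprS; ring.
have coef0 x (p : {poly F}) : ((1 - x *: 'X) * p)`_0 = p`_0.
  by rewrite mulrBl mul1r -scalerAl coefB coefZ coefXM /= mulr0 subr0.
elim: s q => [|j s IH] q h.
  rewrite /recip_prod !big_nil lexx andbT coef1.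
  by case: q => [|q] //=; rewrite ?mulr1 ?mulr0.
have {}IH q' := IH q' (fun i hi => h i (mem_behead (s := j :: s) hi)).
have /andP[f0 fg] := h j (mem_head _ _).
rewrite /recip_prod !map_cons !big_cons -!/(recip_prod _).
case: q => [|q]; first by rewrite !coef0.
rewrite !coefS; have /andP[a0 ab] := IH q.+1; have /andP[c0 cd] := IH q.
apply/andP; split; first by apply: addr_ge0 => //; apply: mulr_ge0.
by apply: lerD => //; apply: ler_pM.
Qed.

(** * Multiple-angle polynomials *)

Lemma cos_sin_exp (R : realType) (x : R) n :
  (cos x +i* sin x) ^+ n = cos (n%:R * x) +i* sin (n%:R * x).
Proof.
elim: n => [|n IH]; first by rewrite mul0r cos0 sin0.
by rewrite exprS IH -natr1 mulrDl mul1r addrC cosD sinD; simpc;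
  congr (_ +i* _); ring.
Qed.

Lemma sum_even_odd (V : nmodType) (F : nat -> V) n :
  \sum_(i < n.*2) F i = \sum_(i < n) (F i.*2 + F i.*2.+1).
Proof.
elim: n => [|n IH]; first by rewrite !big_ord0.
by rewrite doubleS !big_ord_recr /= IH addrA.
Qed.

(** The imaginary part of de Moivre's formula: the terms of even index in the
    binomial expansion are real, those of odd index are purely imaginary. *)
Lemma sin_odd_mul (R : realType) (x : R) N :
  sin (N.*2.+1%:R * x) =
  \sum_(k < N.+1) (-1) ^+ k * 'C(N.*2.+1, k.*2.+1)%:R *
    cos x ^+ (N - k).*2 * sin x ^+ k.*2.+1.
Proof.
have := cos_sin_exp x N.*2.+1.
have -> : cos x +i* sin x = (cos x)%:C + 'i%C * (sin x)%:C.
  exact: complexE.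
rewrite exprDn -doubleS.
rewrite (sum_even_odd (fun i => ((cos x)%:C ^+ (N.*2.+1 - i) *
           ('i%C * (sin x)%:C) ^+ i) *+ 'C(N.*2.+1, i))).
move=> /(congr1 (@complex.Im R)) /= <-.
rewrite raddf_sum /=; apply: eq_bigr => k _.
have hN : (N.*2.+1 - k.*2.+1 = (N - k).*2)%N by rewrite subSS doubleB.
have even_real : ((cos x)%:C ^+ (N.*2.+1 - k.*2) *
    ('i%C * (sin x)%:C) ^+ k.*2) *+ 'C(N.*2.+1, k.*2) =
    ((cos x ^+ (N.*2.+1 - k.*2) * ((-1) ^+ k * sin x ^+ k.*2)) *+
       'C(N.*2.+1, k.*2))%:C.
  rewrite rmorphMn !rmorphM !rmorphXn rmorphN rmorph1 exprMn.
  by rewrite -[in 'i%C ^+ _]mul2n exprM sqr_i.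
have odd_imag : ((cos x)%:C ^+ (N.*2.+1 - k.*2.+1) *
    ('i%C * (sin x)%:C) ^+ k.*2.+1) *+ 'C(N.*2.+1, k.*2.+1) =
    'i%C * ((-1) ^+ k * 'C(N.*2.+1, k.*2.+1)%:R *
    cos x ^+ (N - k).*2 * sin x ^+ k.*2.+1)%:C.
  rewrite !rmorphM !rmorphXn rmorphN rmorph1 rmorph_nat exprMn hN.
  rewrite exprS -[in 'i%C ^+ _]mul2n exprM sqr_i -mulr_natr.
  by ring.
by rewrite even_real odd_imag; simpc.
Qed.

(** * Bounds on sine *)

Lemma is_derive_ge0_le (R : realType) (f df : R -> R) (a b : R) : a <= b ->
  (forall x : R, is_derive x 1 f (df x)) ->
  (forall x, x \in `]a, b[ -> 0 <= df x) -> f a <= f b.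
Proof.
move=> ab hf h; apply: (@ger0_derive1_ndecr R f a b) => //.
- by move=> x hx; rewrite derive1E derive_val h.
- apply: continuous_subspaceT => x.
  exact/differentiable_continuous/derivable1_diffP.
Qed.

Lemma sin_le (R : realType) (x : R) : 0 <= x -> sin x <= x.
Proof.
move=> x0; have h (t : R) : is_derive t 1 (fun y : R => y - sin y) (1 - cos t).
  exact: is_deriveB.
have := is_derive_ge0_le x0 h; rewrite sin0 subrr subr_ge0; apply => t _.
by rewrite subr_ge0 cos_le1.
Qed.

Lemma mul_cos_le_sin (R : realType) (x : R) : 0 <= x <= pi ->
  x * cos x <= sin x.
Proof.
case/andP => x0 xpi.
have h (t : R) : is_derive t 1 (fun y : R => sin y - y * cos y) (t * sin t).
  apply: is_derive_eq; rewrite /GRing.scale /=; ring.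
have := is_derive_ge0_le x0 h; rewrite sin0 mul0r subrr subr_ge0.
apply => t; rewrite in_itv /= => /andP[t0 tx].
by rewrite mulr_ge0 ?(ltW t0) // sin_ge0_pi // (ltW t0) (le_trans (ltW tx)).
Qed.

(** * Closed forms for symmetric functions of cotangents and cosecants *)

Definition angle (R : realType) (N j : nat) : R := j%:R * (pi / N.*2.+1%:R).

Lemma sin_odd_angle (R : realType) N j :
  sin (N.*2.+1%:R * angle R N j) = 0.
Proof.
rewrite /angle mulrCA (mulrCA N.*2.+1%:R) mulfV ?pnatr_eq0 // mulr1.
elim: j => [|j IH]; first by rewrite mul0r sin0.
by rewrite -natr1 mulrDl mul1r sinDpi IH oppr0.
Qed.

Lemma angle_itv (R : realType) N j :
  (0 < j <= N)%N -> 0 < angle R N j < pi / 2.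
Proof.
case/andP => j0 jN; rewrite /angle mulr_gt0 ?ltr0n ?divr_gt0 ?pi_gt0 //=.
rewrite mulrCA ltr_pM2l ?pi_gt0 // ltr_pdivrMr ?ltr0n //.
rewrite mulrC ltr_pdivlMr // -natrM ltr_nat muln2 ltnS leq_double //.
Qed.

Lemma sin_angle_gt0 (R : realType) N j :
  j \in iota 1 N -> 0 < sin (angle R N j).
Proof.
rewrite mem_iota add1n ltnS => /(angle_itv R) hj.
by rewrite sin_gt0_pihalf.
Qed.

Lemma cos_angle_gt0 (R : realType) N j :
  j \in iota 1 N -> 0 < cos (angle R N j).
Proof.
rewrite mem_iota add1n ltnS => /(angle_itv R)/andP[j0 jpi].
rewrite cos_gt0_pihalf // jpi andbT (lt_trans _ j0) //.
by rewrite oppr_lt0 divr_gt0 ?pi_gt0.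
Qed.

Lemma angle_inj (R : realType) N : injective (angle R N).
Proof.
move=> i j /mulIf hij; apply/eqP; rewrite -(eqr_nat R); apply/eqP; apply: hij.
by rewrite mulf_neq0 ?invr_eq0 ?pnatr_eq0 // gt_eqF ?pi_gt0.
Qed.

(** Let n = 2N + 1.  This polynomial is sin (n x) / (n cos^n x tan x), written in
    the variable tan^2 x. *)
Definition tan_poly (R : realType) (N : nat) : {poly R} :=
  \poly_(k < N.+1) ((-1) ^+ k * 'C(N.*2.+1, k.*2.+1)%:R / N.*2.+1%:R).

(** For n = 2N + 1 this polynomial is sin (n x) / (n sin x), written in the
    variable sin^2 x. *)
Definition sin_poly (R : realType) (N : nat) : {poly R} :=
  N.*2.+1%:R^-1 *: \sum_(k < N.+1)
    ((-1) ^+ k * 'C(N.*2.+1, k.*2.+1)%:R) *: ('X^k * (1 - 'X) ^+ (N - k)).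

(** At the angles j pi/(2N+1), 1 <= j <= N, the multiple-angle sine vanishes, and
    the squares of the tangents are distinct there; these N values are therefore
    all the roots. *)
Lemma tan_polyE (R : realType) N : tan_poly R N =
  recip_prod [seq (tan (angle R N j) ^+ 2)^-1 | j <- iota 1 N].
Proof.
have tan_gt0 j : j \in iota 1 N -> 0 < tan (angle R N j).
  by move=> hj; rewrite divr_gt0 ?sin_angle_gt0 ?cos_angle_gt0.
rewrite (map_comp (fun x => x^-1) (fun j => tan (angle R N j) ^+ 2)).
apply: poly_eq_recip_prod.
- by rewrite size_map size_iota size_poly.
- by rewrite coef_poly /= mul1r bin1 mulfV ?pnatr_eq0.
- rewrite map_inj_in_uniq ?iota_uniq // => i j hi hj /eqP.
  rewrite eqrXn2 ?ltW ?tan_gt0 // => /eqP/tan_inj.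
  have hI k : k \in iota 1 N -> angle R N k \in `](- (pi/2)), (pi/2)[%R.
    rewrite mem_iota add1n ltnS => /(angle_itv R)/andP[k0 kpi].
    rewrite in_itv /= kpi andbT (lt_trans _ k0) //.
    by rewrite oppr_lt0 divr_gt0 ?pi_gt0.
  by move=> h; apply: (@angle_inj R N); apply: h; apply: hI.
- by apply/mapP => -[j hj /esym/eqP]; rewrite expf_eq0 gt_eqF ?tan_gt0.
- apply/allP => _ /mapP[j hj ->]; have t0 := tan_gt0 j hj.
  have c0 : cos (angle R N j) != 0 by rewrite gt_eqF ?cos_angle_gt0.
  (* Times this nonzero factor, the value at tan^2 is sin (n x) = 0. *)
  have d0 : N.*2.+1%:R * cos (angle R N j) ^+ N.*2.+1 * tan (angle R N j)
      != 0 :> R.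
    apply: mulf_neq0; last by rewrite gt_eqF.
    by rewrite mulf_neq0 ?expf_neq0 ?pnatr_eq0.
  rewrite /root -(mulrI_eq0 _ (lregP d0)) horner_poly mulr_sumr.
  rewrite -[X in _ == X](sin_odd_angle R N j) sin_odd_mul; apply/eqP.
  apply: eq_bigr => k _; have hk : (k <= N)%N by rewrite -ltnS.
  rewrite -exprM mul2n /tan.
  have -> : cos (angle R N j) ^+ N.*2.+1 =
      cos (angle R N j) ^+ (N - k).*2 * cos (angle R N j) ^+ k.*2.+1.
    by rewrite -exprD addnS -doubleD subnK.
  rewrite expr_div_n !exprS; field.
  by rewrite nat1r expf_neq0 ?c0 ?pnatr_eq0.
Qed.

Lemma sin_polyE (R : realType) N : sin_poly R N =
  recip_prod [seq (sin (angle R N j) ^+ 2)^-1 | j <- iota 1 N].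
Proof.
rewrite (map_comp (fun x => x^-1) (fun j => sin (angle R N j) ^+ 2)).
apply: poly_eq_recip_prod.
- rewrite size_map size_iota (leq_trans (size_scale_leq _ _)) //.
  apply: (leq_trans (size_sum _ _ _)); apply/bigmax_leqP => k _.
  apply: (leq_trans (size_scale_leq _ _)).
  apply: (leq_trans (size_polyMleq _ _)); rewrite size_polyXn /=.
  have h2 : (size (1 - 'X : {poly R})%R <= 2)%N.
    rewrite (leq_trans (size_polyD _ _)) // geq_max size_poly1 size_polyN.
    by rewrite size_polyX.
  have hN : (k + (N - k).+1 = N.+1)%N by rewrite addnS subnKC // -ltnS.
  apply: (@leq_trans (k + (N - k).+1)%N); last by rewrite hN.
  rewrite leq_add2l (leq_trans (size_poly_exp_leq _ _)) // ltnS.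
  by rewrite -[X in (_ <= X)%N]mul1n leq_mul // -ltnS; case: size h2.
- rewrite coefZ coef_sum big_ord_recl big1 ?addr0 /=.
    rewrite coefZ mul1r bin1 coefXnM ltnn !subn0 -horner_coef0 !hornerE.
    by rewrite subr0 expr1n /= mulr1 mulVf ?pnatr_eq0.
  by move=> k _; rewrite coefZ coefXnM /= mulr0.
- rewrite map_inj_in_uniq ?iota_uniq // => i j hi hj /eqP.
  rewrite eqrXn2 ?ltW ?sin_angle_gt0 // => /eqP/sin_inj.
  have hI k : k \in iota 1 N -> angle R N k \in `[(- (pi/2)), (pi/2)]%R.
    rewrite mem_iota add1n ltnS => /(angle_itv R)/andP[k0 kpi].
    rewrite in_itv /= (ltW kpi) andbT (le_trans _ (ltW k0)) //.
    by rewrite oppr_le0 ltW ?divr_gt0 ?pi_gt0.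
  by move=> h; apply: (@angle_inj R N); apply: h; apply: hI.
- by apply/mapP => -[j hj /esym/eqP]; rewrite expf_eq0 gt_eqF ?sin_angle_gt0.
- apply/allP => _ /mapP[j hj ->]; have s0 := sin_angle_gt0 R hj.
  (* Times this nonzero factor, the value at sin^2 is sin (n x) = 0. *)
  have d0 : N.*2.+1%:R * sin (angle R N j) != 0 :> R.
    by rewrite mulf_neq0 ?pnatr_eq0 // gt_eqF.
  rewrite /root -(mulrI_eq0 _ (lregP d0)) /sin_poly hornerZ horner_sum.
  rewrite [N.*2.+1%:R * _]mulrC mulrA mulfK ?pnatr_eq0 // mulr_sumr.
  rewrite -[X in _ == X](sin_odd_angle R N j) sin_odd_mul; apply/eqP.
  apply: eq_bigr => k _; rewrite !hornerE.
  by rewrite -cos2sin2 -!exprM !mul2n exprS /=; ring.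
Qed.

(** * The limit of the elementary symmetric functions of 1/j^2 *)

(** Listed by decreasing j, so that passing from N to N + 1 adds a new head. *)
Definition inv_powers (R : realType) (k N : nat) : seq R :=
  [seq (j%:R ^+ k)^-1 | j <- rev (iota 1 N)].

Lemma inv_powersS (R : realType) k N :
  inv_powers R k N.+1 = (N.+1%:R ^+ k)^-1 :: inv_powers R k N.
Proof. by rewrite /inv_powers -[N.+1]addn1 iotaD rev_cat /= add1n addn1. Qed.

Lemma recip_prod_inv_powers (R : realType) k N :
  recip_prod (inv_powers R k N) =
  recip_prod [seq (j%:R ^+ k)^-1 | j <- iota 1 N].
Proof. by rewrite /recip_prod !big_map; apply: perm_big; rewrite perm_rev. Qed.

Lemma coef_tan_poly (R : realType) N q :
  (-1) ^+ q * (tan_poly R N)`_q = 'C(N.*2.+1, q.*2.+1)%:R / N.*2.+1%:R.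
Proof.
rewrite coef_poly; case: ifP => hq.
  by rewrite !mulrA -exprMn mulrNN mulr1 expr1n mul1r.
by rewrite bin_small ?mul0r ?mulr0 // ltnS ltn_double ltnNge -ltnS hq.
Qed.

Lemma coef_1subXn (R : comNzRingType) n i :
  ((1 - 'X) ^+ n : {poly R})`_i = (-1) ^+ i * 'C(n, i)%:R.
Proof.
rewrite exprBn coef_sum.
have E (j : 'I_n.+1) :
    ((-1) ^+ j * 1 ^+ (n - j) * 'X ^+ j *+ 'C(n, j) : {poly R})`_i =
    (i == j)%:R * ((-1) ^+ j * 'C(n, j)%:R).
  rewrite expr1n mulr1 -(rmorph_sign polyC) mul_polyC coefMn coefZ coefXn.
  rewrite -[LHS]mulr_natr; ring.
under eq_bigr do rewrite E.
case: (ltnP i n.+1) => hi.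
  rewrite (bigD1 (Ordinal hi)) //= eqxx mul1r big1 ?addr0 // => j.
  by rewrite -val_eqE /= eq_sym => /negPf ->; rewrite mul0r.
rewrite bin_small // mulr0 big1 // => j _.
by rewrite gtn_eqF ?mul0r // (leq_trans (ltn_ord j)).
Qed.

(** The sum runs to q rather than to min(q, N): for k > N the first binomial
    coefficient vanishes. *)
Lemma coef_sin_poly (R : realType) N q :
  (-1) ^+ q * (sin_poly R N)`_q =
  (\sum_(k < q.+1) 'C(N.*2.+1, k.*2.+1)%:R * 'C(N - k, q - k)%:R) / N.*2.+1%:R.
Proof.
rewrite coefZ coef_sum mulrCA mulrC; congr (_ / _); rewrite mulr_sumr.
pose G k : R := 'C(N.*2.+1, k.*2.+1)%:R *
  (if (k <= q)%N then 'C(N - k, q - k)%:R else 0).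
have E (k : 'I_N.+1) : (-1) ^+ q * (((-1) ^+ k * 'C(N.*2.+1, k.*2.+1)%:R) *:
    ('X^k * (1 - 'X) ^+ (N - k)) : {poly R})`_q = G k.
  rewrite coefZ coefXnM coef_1subXn /G.
  case: ltnP => hk; first by rewrite !mulr0.
  rewrite -[in (-1) ^+ q](subnKC hk) exprD.
  have -> (a b x y : R) :
      a * b * (a * x * (b * y)) = (a * a) * (b * b) * (x * y) by ring.
  by rewrite -!exprMn mulrNN mulr1 !expr1n !mul1r.
under eq_bigr do rewrite E.
have -> : \sum_(k < q.+1) 'C(N.*2.+1, k.*2.+1)%:R * 'C(N - k, q - k)%:R =
    \sum_(k < q.+1) G k.
  by apply: eq_bigr => k _; rewrite /G -ltnS ltn_ord.
rewrite -!(big_mkord xpredT G).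
have pad a b : (a <= b)%N -> (forall k, (a <= k < b)%N -> G k = 0) ->
    \sum_(0 <= k < b) G k = \sum_(0 <= k < a) G k.
  move=> ab h; rewrite (big_cat_nat (n := a)) //= [X in _ + X]big_nat_cond.
  rewrite [X in _ + X]big1 ?addr0 //.
  by move=> k; rewrite andbT => /h.
case/orP: (leq_total N q) => hNq.
  apply/esym/pad; rewrite ?ltnS // => k /andP[hk _].
  by rewrite /G bin_small ?mul0r // ltnS ltn_double.
by apply: pad; rewrite ?ltnS // => k /andP[hk _]; rewrite /G leqNgt hk mulr0.
Qed.

(** Writing x = j pi/n, the inequality x cos x <= sin x <= x says that 1/j^2 lies
    between the multiples by (pi/n)^2 of cot^2 x and of 1/sin^2 x. *)
Lemma inv_squares_bounds (R : realType) (N q : nat) (n := N.*2.+1) :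
  pi ^+ q.*2 * ('C(n, q.*2.+1)%:R / n%:R ^+ q.*2.+1)
  <= (-1) ^+ q * (recip_prod (inv_powers R 2 N))`_q <=
  pi ^+ q.*2 * \sum_(k < q.+1) 'C(n, k.*2.+1)%:R / n%:R ^+ k.*2.+1 *
                 ('C(N - k, q - k)%:R / n%:R ^+ (q - k).*2).
Proof.
have n0 : 0 < n%:R :> R by rewrite ltr0n.
pose c : R := (pi / n%:R) ^+ 2.
have cq x : c ^+ q * (x / n%:R) = pi ^+ q.*2 * (x / n%:R ^+ q.*2.+1).
  rewrite /c -exprM mul2n expr_div_n exprS; field.
  by rewrite expf_neq0 gt_eqF.
have scale (f : nat -> R) :
    c ^+ q * ((-1) ^+ q * (recip_prod [seq f j | j <- iota 1 N])`_q) =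
    (-1) ^+ q * (recip_prod [seq c * f j | j <- iota 1 N])`_q.
  by rewrite mulrCA -coef_comp_scaleX recip_prod_scale -map_comp.
have jpos j : j \in iota 1 N -> 0 < j%:R :> R.
  by rewrite mem_iota ltr0n => /andP[].
rewrite recip_prod_inv_powers; apply/andP; split.
- rewrite -cq -coef_tan_poly tan_polyE scale.
  apply: (fun h => proj2 (andP (coef_recip_prod_le q h))) => j hj.
  have s0 := sin_angle_gt0 R hj; have c0 := cos_angle_gt0 R hj.
  have j0 := jpos j hj.
  rewrite mulr_ge0 ?invr_ge0 ?sqr_ge0 //= /c -!exprVn -exprMn.
  rewrite lerXn2r ?nnegrE ?mulr_ge0 ?invr_ge0 ?pi_ge0 ?divr_ge0 ?(ltW j0)
    ?(ltW s0) ?(ltW c0) //.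
  rewrite /tan invf_div mulrA ler_pdivrMr // [j%:R^-1 * _]mulrC.
  rewrite ler_pdivlMr // mulrAC [_ * j%:R]mulrC -/(angle R N j).
  rewrite mul_cos_le_sin //.
  have /andP[a0 api] : 0 < angle R N j < pi / 2.
    by apply: angle_itv; move: hj; rewrite mem_iota add1n ltnS.
  rewrite (ltW a0) (le_trans (ltW api)) //.
  by rewrite ler_pdivrMr // ler_peMr ?pi_ge0 // ler1n.
- have -> : pi ^+ q.*2 * \sum_(k < q.+1) 'C(n, k.*2.+1)%:R / n%:R ^+ k.*2.+1 *
                 ('C(N - k, q - k)%:R / n%:R ^+ (q - k).*2) =
            c ^+ q * ((-1) ^+ q * (sin_poly R N)`_q).
    rewrite coef_sin_poly cq mulr_suml; congr (_ * _); apply: eq_bigr => k _.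
    have -> : q.*2.+1 = (k.*2.+1 + (q - k).*2)%N.
      by rewrite addSn -doubleD subnKC // -ltnS.
    by rewrite exprD invfM; ring.
  rewrite sin_polyE scale.
  apply: (fun h => proj2 (andP (coef_recip_prod_le q h))) => j hj.
  have s0 := sin_angle_gt0 R hj; have j0 := jpos j hj.
  rewrite invr_ge0 exprn_ge0 ?(ltW j0) //= /c -!exprVn -exprMn.
  rewrite lerXn2r ?nnegrE ?mulr_ge0 ?invr_ge0 ?pi_ge0 ?(ltW j0) ?(ltW s0) //.
  rewrite ler_pdivlMr // mulrC ler_pdivrMr // mulrC -/(angle R N j).
  by rewrite sin_le // mulr_ge0 ?divr_ge0 ?pi_ge0.
Qed.

Lemma bin_le_exp a b : ('C(a, b) <= a ^ b)%N.
Proof.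
elim: b => [|b IH]; first by rewrite bin0.
apply: (@leq_trans (b.+1 * 'C(a, b.+1))); first by rewrite leq_pmull.
by rewrite mul_bin_left expnS leq_mul // leq_subr.
Qed.

Lemma cvg_lim_eq (R : realType) (u : nat -> R) (l l' : R) :
  u @ \oo --> l -> l = l' -> u @ \oo --> l'.
Proof. by move=> h <-. Qed.

Lemma cvg_sum_seq (R : realType) (I : Type) (r : seq I) (P : pred I)
    (u : I -> nat -> R) (l : I -> R) :
  (forall i, P i -> u i N @[N --> \oo] --> l i) ->
  \sum_(i <- r | P i) u i N @[N --> \oo] --> \sum_(i <- r | P i) l i.
Proof. by move=> h; apply: cvg_big => //; apply: add_continuous. Qed.

Lemma cvg_prod_seq (R : realType) (I : Type) (r : seq I) (P : pred I)
    (u : I -> nat -> R) (l : I -> R) :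
  (forall i, P i -> u i N @[N --> \oo] --> l i) ->
  \prod_(i <- r | P i) u i N @[N --> \oo] --> \prod_(i <- r | P i) l i.
Proof. by move=> h; apply: cvg_big => //; apply: mul_continuous. Qed.

Lemma cvg_bin (R : realType) k :
  ('C(n, k)%:R / n%:R ^+ k : R) @[n --> \oo] --> (k`!%:R^-1 : R).
Proof.
elim: k => [|k IH].
  under eq_fun do rewrite bin0 expr0 divr1. 
  by rewrite fact0 invr1; apply: cvg_cst.
(* 'C(n, k + 1) is 'C(n, k) (n - k) / (k + 1). *)
have h : ((n%:R - k%:R) / n%:R : R) @[n --> \oo] --> (1 : R).
  have : (1 - k%:R * n.+1%:R^-1 : R) @[n --> \oo] --> (1 - k%:R * 0 : R).
    apply: cvgB; first exact: cvg_cst.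
    apply: cvgM; first exact: cvg_cst.
    exact: cvg_harmonic.
  rewrite mulr0 subr0 -(cvg_shiftS (fun n => (n%:R - k%:R) / n%:R : R)) /=.
  apply: cvg_trans; apply: near_eq_cvg; near=> n.
  by rewrite mulrBl mulfV ?pnatr_eq0.
have -> : (k.+1)`!%:R^-1 = k`!%:R^-1 * k.+1%:R^-1 * 1 :> R.
  by rewrite factS natrM invfM mulrC mulr1.
have : ('C(n, k)%:R / n%:R ^+ k * k.+1%:R^-1 * ((n%:R - k%:R) / n%:R) : R)
    @[n --> \oo] --> (k`!%:R^-1 * k.+1%:R^-1 * 1 : R).
  by apply: cvgM => //; apply: cvgM => //; apply: cvg_cst.
apply: cvg_trans; apply: near_eq_cvg; near=> n.
have kn : (k <= n)%N by near: n; exact: nbhs_infty_ge.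
rewrite /= -natrB //.
have -> : 'C(n, k.+1)%:R = 'C(n, k)%:R * (n - k)%:R / k.+1%:R :> R.
  apply: (canRL (mulfK _)); rewrite ?pnatr_eq0 // -!natrM mulnC.
  by rewrite mul_bin_left mulnC.
by rewrite exprSr invfM; ring.
Unshelve. all: by end_near. Qed.

Lemma cvg_bin_odd (R : realType) k :
  ('C(N.*2.+1, k)%:R / N.*2.+1%:R ^+ k : R) @[N --> \oo] --> (k`!%:R^-1 : R).
Proof.
have h : N.*2.+1 @[N --> \oo] --> \oo.
  apply/cvgnyPge => A; near=> N.
  rewrite (@leq_trans N) //; first by near: N; exact: nbhs_infty_ge.
  by rewrite -addnn -addnS leq_addr.
exact: (cvg_comp _ _ h (@cvg_bin R k)).
Unshelve. all: by end_near. Qed.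

(** The coefficient of x^(2q) in sin(pi x)/(pi x).  In the upper bound of
    inv_squares_bounds only the term k = q survives in the limit; each of the
    others is at most a bounded quantity divided by N + 1. *)
Lemma cvg_recip_prod_inv_squares (R : realType) q :
  (recip_prod (inv_powers R 2 N))`_q @[N --> \oo] -->
    ((-1) ^+ q * pi ^+ q.*2 / (q.*2.+1)`!%:R : R).
Proof.
suff h : (-1) ^+ q * (recip_prod (inv_powers R 2 N))`_q @[N --> \oo] -->
    (pi ^+ q.*2 / (q.*2.+1)`!%:R : R).
  rewrite -mulrA.
  have : ((-1) ^+ q * ((-1) ^+ q * (recip_prod (inv_powers R 2 N))`_q))
      @[N --> \oo] --> ((-1) ^+ q * (pi ^+ q.*2 / (q.*2.+1)`!%:R) : R).
    by apply: cvgM => //; apply: cvg_cst.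
  apply: cvg_trans.
  apply: near_eq_cvg; apply: nearW => N /=.
  by rewrite mulrA -exprMn mulrNN mulr1 expr1n mul1r.
apply: squeeze_cvgr.
- by apply: nearW => N; apply: inv_squares_bounds.
- by apply: cvgM; [exact: cvg_cst | exact: cvg_bin_odd].
- apply: cvgM; first exact: cvg_cst.
  rewrite -[(q.*2.+1)`!%:R^-1]addr0.
  under eq_fun do rewrite big_ord_recr /= addrC.
  apply: cvgD.
    rewrite -[(q.*2.+1)`!%:R^-1]mulr1; apply: cvgM; first exact: cvg_bin_odd.
    under eq_fun do rewrite subnn bin0 expr0 divr1.
    exact: cvg_cst.
  apply: (cvg_lim_eq (l := \sum_(k < q) (k.*2.+1)`!%:R^-1 * 0)); last first.
    by rewrite big1 // => k _; rewrite mulr0.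
  apply: (cvg_sum_seq (u := fun (k : 'I_q) N =>
    'C(N.*2.+1, k.*2.+1)%:R / N.*2.+1%:R ^+ k.*2.+1 *
      ('C(N - k, q - k)%:R / N.*2.+1%:R ^+ (q - k).*2))) => k _; apply: cvgM.
    exact: cvg_bin_odd.
  apply: (squeeze_cvgr (f := fun=> 0) (h := harmonic)).
  - apply: nearW => N; rewrite divr_ge0 ?ler0n ?exprn_ge0 //=.
    have kq : (0 < q - k)%N by rewrite subn_gt0.
    rewrite ler_pdivrMr ?exprn_gt0 ?ltr0n // ler_pdivlMl ?ltr0n //.
    rewrite -natrX -natrM ler_nat mulnC -[(q - k).*2]addnn expnD leq_mul //.
      rewrite (leq_trans (bin_le_exp _ _)) // leq_exp2r // leqW //.
      by rewrite (leq_trans (leq_subr _ _)) // -addnn leq_addr.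
    rewrite (@leq_trans (N.*2.+1 ^ 1)) ?leq_pexp2l //.
    by rewrite expn1 ltnS -addnn leq_addr.
  - exact: cvg_cst.
  - exact: cvg_harmonic.
Qed.

(** * Polynomial approximation at 0 *)

(** Agreement of f with p up to O(t^N) near 0, with the point 0 left out: this is
    enough to multiply and compare Taylor coefficients of t/(e^t - 1) without
    Cauchy products or a value at 0. *)
Definition expands (R : realType) (f : R -> R) (p : {poly R}) (N : nat) :=
  exists C r : R, 0 < r /\
    forall t, 0 < `|t| < r -> `|f t - p.[t]| <= C * `|t| ^+ N.

Lemma poly_bounded (R : realType) (p : {poly R}) :
  exists M : R, forall t, `|t| <= 1 -> `|p.[t]| <= M.
Proof.
exists (\sum_(i < size p) `|p`_i|) => t t1.
rewrite horner_coef (le_trans (ler_norm_sum _ _ _)) // ler_sum // => i _.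
by rewrite normrM normrX ler_piMr // exprn_ile1.
Qed.

Lemma expands_horner (R : realType) (p : {poly R}) N : expands (horner p) p N.
Proof.
by exists 0, 1; split => // t _; rewrite subrr normr0 mul0r.
Qed.

Lemma expandsD (R : realType) (f g : R -> R) p q N :
  expands f p N -> expands g q N -> expands (fun t => f t + g t) (p + q) N.
Proof.
move=> [C [r [r0 hf]]] [D [s [s0 hg]]].
exists (C + D), (Num.min r s); rewrite lt_min r0 s0; split => // t.
rewrite lt_min => /and3P[t0 tr ts]; rewrite hornerD opprD addrACA mulrDl.
rewrite (le_trans (ler_normD _ _)) // lerD ?hf ?hg ?t0 //.
Qed.

Lemma expandsZ (R : realType) (f : R -> R) p N c :
  expands f p N -> expands (fun t => c * f t) (c *: p) N.
Proof.
move=> [C [r [r0 hf]]]; exists (`|c| * C), r; split => // t ht.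
by rewrite hornerZ -mulrBr normrM -mulrA ler_wpM2l ?hf.
Qed.

Lemma expandsM (R : realType) (f g : R -> R) p q N :
  expands f p N -> expands g q N -> expands (fun t => f t * g t) (p * q) N.
Proof.
move=> [C [r [r0 hf]]] [D [s [s0 hg]]].
have [K hK] := poly_bounded q; have [L hL] := poly_bounded p.
exists (`|C| * (`|D| + K) + L * `|D|), (Num.min 1 (Num.min r s)).
rewrite !lt_min ltr01 r0 s0; split => // t.
rewrite !lt_min => /and4P[t0 /ltW t1 tr ts].
have {}hf : `|f t - p.[t]| <= `|C| * `|t| ^+ N.
  by rewrite (le_trans (hf _ _)) ?t0 // ler_wpM2r ?exprn_ge0 // ler_norm.
have {}hg : `|g t - q.[t]| <= `|D| * `|t| ^+ N.
  by rewrite (le_trans (hg _ _)) ?t0 // ler_wpM2r ?exprn_ge0 // ler_norm.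
have -> : f t * g t - (p * q).[t] =
    (f t - p.[t]) * ((g t - q.[t]) + q.[t]) + p.[t] * (g t - q.[t]).
  by rewrite hornerM; ring.
rewrite [leRHS]mulrDl (le_trans (ler_normD _ _)) // lerD // normrM.
  rewrite mulrAC ler_pM // (le_trans (ler_normD _ _)) // lerD ?hK //.
  by rewrite (le_trans hg) // ler_piMr // exprn_ile1.
by rewrite -mulrA ler_pM // hL.
Qed.

Lemma expands_scale (R : realType) (f : R -> R) p N c : c != 0 ->
  expands f p N -> expands (fun t => f (c * t)) (p \Po (c *: 'X)) N.
Proof.
move=> c0 [C [r [r0 hf]]]; exists (C * `|c| ^+ N), (r / `|c|).
have nc : 0 < `|c| by rewrite normr_gt0.
split; first by rewrite divr_gt0.
move=> t /andP[t0 tr]; rewrite horner_comp !hornerE -mulrA -exprMn -normrM.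
by apply: hf; rewrite normrM mulr_gt0 //= mulrC -ltr_pdivlMr.
Qed.

Lemma eq_expands (R : realType) (f g : R -> R) p N (r : R) : 0 < r ->
  (forall t, 0 < `|t| < r -> f t = g t) -> expands f p N -> expands g p N.
Proof.
move=> r0 fg [C [s [s0 hf]]]; exists C, (Num.min r s).
rewrite lt_min r0 s0; split => // t; rewrite lt_min => /and3P[t0 tr ts].
by rewrite -fg ?t0 // hf ?t0.
Qed.

(** The lowest coefficient is a limit of values that tend to 0; divide by t and
    iterate. *)
Lemma expands0_coef (R : realType) (p : {poly R}) N i :
  expands (fun=> 0) p N -> (i < N)%N -> p`_i = 0.
Proof.
elim: N p i => // N IH p i [C [r [r0 hp]]].
have [q [c pE]] : exists (q : {poly R}) (c : R), p = q * 'X + c%:P.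
  elim/poly_ind: p {hp} => [|q c _]; last by exists q, c.
  by exists 0, 0; rewrite mul0r addr0.
subst p; have [K hK] := poly_bounded q.
have K0 : 0 <= K by rewrite (le_trans _ (hK 0 _)) ?normr0.
have c0 : c = 0.
  apply/eqP; rewrite -normr_le0; apply/ler_addgt0Pr => e e0; rewrite add0r.
  pose t := Num.min (Num.min (r / 2) 1) (e / (`|C| + K + 1)).
  have CK : 0 < `|C| + K + 1 by rewrite ltr_wpDl ?addr_ge0.
  have t0 : 0 < t by rewrite !lt_min divr_gt0 ?divr_gt0 ?ltr01.
  have t1 : t <= 1 by rewrite !ge_min lexx orbT.
  have tr : t < r by rewrite !gt_min ltr_pdivrMr // mulrDr mulr1 ltrDl r0.
  have te : t * (`|C| + K + 1) <= e.
    by rewrite -ler_pdivlMr // ge_min lexx orbT.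
  have nt : `|t| = t by rewrite gtr0_norm.
  have := hp t; rewrite nt t0 tr => /(_ isT).
  rewrite sub0r normrN !hornerE => h.
  have -> : c = (q.[t] * t + c) - q.[t] * t by ring.
  rewrite (le_trans (ler_normB _ _)) // (le_trans _ te) //.
  rewrite mulrDr mulrDr -addrA lerD //.
    rewrite (le_trans h) // exprS mulrCA ler_wpM2l ?(ltW t0) //.
    rewrite (le_trans (ler_norm _)) // normrM ler_piMr // normrX nt.
    by rewrite exprn_ile1 // ltW.
  rewrite normrM nt mulrC mulr1 -[leLHS]addr0 lerD ?(ltW t0) //.
  rewrite ler_wpM2l ?(ltW t0) //.
  by rewrite hK ?nt.
rewrite c0 addr0 coefMX; case: i => //= i; rewrite ltnS => iN.
apply: IH iN; exists C, r; split => // t ht; have /andP[t0 tr] := ht.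
have := hp t ht; rewrite c0 addr0 hornerMX !sub0r !normrN normrM exprS.
by rewrite mulrCA mulrC ler_pM2l.
Qed.

Lemma expands_uniq (R : realType) (f : R -> R) p q N i :
  expands f p N -> expands f q N -> (i < N)%N -> p`_i = q`_i.
Proof.
move=> hp hq iN; apply/eqP; rewrite -subr_eq0 -coefB; apply/eqP.
apply: expands0_coef iN.
have := expandsD hp (expandsZ (-1) hq); rewrite scaleN1r.
by apply: (@eq_expands _ _ _ _ _ 1) => // t _; ring.
Qed.

Lemma sum_geometric_le (R : realType) (x : R) N k : 0 <= x <= 2^-1 ->
  \sum_(N <= j < N + k) x ^+ j <= 2 * x ^+ N - 2 * x ^+ (N + k).
Proof.
case/andP => x0 x1; elim: k => [|k IH].
  by rewrite addn0 big_geq // subrr.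
rewrite addnS big_nat_recr ?leq_addr //= exprS.
have := exprn_ge0 (N + k) x0; move: IH; set y := x ^+ (N + k) => IH y0.
have : x * y <= 2^-1 * y by rewrite ler_wpM2r.
lra.
Qed.

(** Convergence at s = r/2 bounds the a_j s^j by some M, so for |t| <= s/2 the tail
    from N on is dominated by a geometric series, of sum at most
    2 M (|t|/s)^N. *)
Lemma expands_series (R : realType) (f : R -> R) (a : nat -> R) (r : R) N :
  0 < r ->
  (forall t, 0 < `|t| < r -> [series a j * t ^+ j]_j @ \oo --> f t) ->
  expands f (\poly_(i < N) a i) N.
Proof.
move=> r0 hf; pose s := r / 2.
have s0 : 0 < s by rewrite divr_gt0.
have sr : 0 < `|s| < r.
  by rewrite gtr0_norm // s0 /s ltr_pdivrMr // mulrDr mulr1 ltrDl.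
have /cvg_series_cvg_0 : cvg ([series a j * s ^+ j]_j @ \oo).
  by apply/cvg_ex; exists (f s); exact: hf.
move=> h; have : cvg ((fun j => a j * s ^+ j) @ \oo) by apply/cvg_ex; exists 0.
move=> /cvg_seq_bounded [M0 [_ hM]].
have [M M0' {}hM] : exists2 M : R, 0 < M & forall j, `|a j| * s ^+ j <= M.
  exists (`|M0| + 1); first by rewrite ltr_pwDr.
  move=> j; have := hM (`|M0| + 1).
  rewrite (le_lt_trans (ler_norm M0)) ?ltrDl // => /(_ isT j I) /=.
  by rewrite normrM normrX (gtr0_norm s0).
exists (2 * M / s ^+ N), (s / 2); split; first by rewrite divr_gt0.
move=> t /andP[t0 ts].
have tr : 0 < `|t| < r.
  have s2 : s / 2 < s by rewrite ltr_pdivrMr // mulrDr mulr1 ltrDl.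
  rewrite t0 (lt_trans ts) // (lt_trans s2) //.
  by case/andP: sr; rewrite gtr0_norm.
have -> : (\poly_(i < N) a i).[t] = \sum_(0 <= j < N) a j * t ^+ j.
  by rewrite horner_poly big_mkord.
have hc : [series a j * t ^+ j]_j n - \sum_(0 <= j < N) a j * t ^+ j
    @[n --> \oo] --> f t - \sum_(0 <= j < N) a j * t ^+ j.
  by apply: cvgB; [exact: hf | exact: cvg_cst].
apply: (cvgr_to_le (cvg_norm hc)); near=> n.
have Nn : (N <= n)%N by near: n; exact: nbhs_infty_ge.
rewrite /series /= (big_cat_nat (n := N)) //= addrAC subrr add0r.
rewrite (le_trans (ler_norm_sum _ _ _)) //.
have x01 : 0 <= `|t| / s <= 2^-1.
  by rewrite divr_ge0 ?(ltW s0) //= ler_pdivrMr // mulrC ltW.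
apply: (@le_trans _ _ (\sum_(N <= j < n) M * (`|t| / s) ^+ j)).
  apply: ler_sum => j _; rewrite normrM normrX expr_div_n mulrA.
  rewrite ler_pdivlMr ?exprn_gt0 //.
  by rewrite mulrAC ler_wpM2r ?exprn_ge0.
rewrite -mulr_sumr -(subnKC Nn).
have := sum_geometric_le N (n - N) x01.
move=> h1; rewrite (le_trans (ler_wpM2l (ltW M0') h1)) //.
apply: (@le_trans _ _ (M * (2 * (`|t| / s) ^+ N))).
  rewrite ler_wpM2l ?(ltW M0') // gerBl mulr_ge0 // exprn_ge0 //.
  by case/andP: x01.
by rewrite expr_div_n; lra.
Unshelve. all: by end_near. Qed.

(** * Bernoulli numbers and the reciprocal of sinh *)

Lemma expands_expR (R : realType) N :
  expands (@expR R) (\poly_(i < N) (i`!%:R)^-1) N.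
Proof.
apply: (expands_series (r := 1)) => // t _.
have -> : [series (j`!%:R)^-1 * t ^+ j]_j = series (exp_coeff t).
  by apply/funext => n; apply: eq_bigr => j _; rewrite /exp_coeff /= mulrC.
exact: is_cvg_series_exp_coeff.
Qed.

Lemma expands_bernoulli (R : realType) (B : nat -> R) N : is_bernoulli B ->
  expands (fun t => t / (expR t - 1)) (\poly_(i < N) (B i / i`!%:R)) N.
Proof.
move=> hB; have [r /= r0 hr] : exists2 r : R, 0 < r & forall t, 0 < `|t| < r ->
    [series B j * t ^+ j / j`!%:R]_j @ \oo --> t / (expR t - 1).
  have [r /= r0 hr] := hB; exists r => // t /andP[t0 tr].
  by apply: hr; rewrite /ball_ /= ?sub0r ?normrN // -normr_gt0.
apply: expands_series r0 _ => t ht.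
have -> : [series B j / j`!%:R * t ^+ j]_j = [series B j * t ^+ j / j`!%:R]_j.
  by apply/funext => n; apply: eq_bigr => j _ /=; rewrite mulrAC.
exact: hr.
Qed.

(** The Taylor coefficients of t/sinh t = 2 b(t) - b(2t), b(t) = t/(e^t - 1). *)
Definition t_over_sinh_coef (R : realType) (B : nat -> R) (j : nat) : R :=
  (2 - 2 ^+ j) * B j / j`!%:R.

(** The coefficient of t^(2n+1) in (t/sinh t) sinh t = t.  Since sinh is odd, only
    the coefficients of even index of t/sinh t occur. *)
Lemma bernoulli_conv (R : realType) (B : nat -> R) n : is_bernoulli B ->
  \sum_(i < n.+1) t_over_sinh_coef B i.*2 / ((n - i).*2.+1)`!%:R =
  (n == 0%N)%:R.
Proof.
move=> hB; set N := n.*2.+2.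
have hb := expands_bernoulli N hB; have he := expands_expR R N.
have two0 : 2 != 0 :> R by rewrite pnatr_eq0.
have hf := expandsD (expandsZ 2 hb) (expandsZ (-1) (expands_scale two0 hb)).
have N10 : -1 != 0 :> R by rewrite oppr_eq0 oner_eq0.
have hg := expandsZ (2^-1) (expandsD he (expandsZ (-1) (expands_scale N10 he))).
set c := 2^-1 *: _ in hg; set d := 2 *: _ + _ in hf.
have hfg : expands id (c * d) N.
  apply: (eq_expands ltr01 _ (expandsM hg hf)) => t /andP[t0 _].
  have ht : t != 0 by rewrite -normr_gt0.
  have e0 := expR_gt0 t.
  have e1 : expR t != 1.
    by apply: contraNneq ht => /eqP; rewrite -expR0 => /eqP/expR_inj ->.
  have -> : expR (2 * t) = expR t * expR t by rewrite mulr_natl mulr2n expRD.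
  have -> : expR (-1 * t) = (expR t)^-1 by rewrite mulN1r expRN.
  set y := expR t in e0 e1 *.
  have y1 : y - 1 != 0 by rewrite subr_eq0.
  have y2 : y + 1 != 0 by rewrite gt_eqF // addr_gt0.
  have y3 : y * y - 1 != 0.
    have -> : y * y - 1 = (y - 1) * (y + 1) by ring.
    by rewrite mulf_neq0.
  by field; rewrite y1 y3 gt_eqF.
have hX : expands (id : R -> R) 'X N.
  apply: (@eq_expands R (horner ('X : {poly R})) id 'X N 1 ltr01).
    by move=> t _; rewrite hornerX.
  exact: expands_horner.
have := expands_uniq hfg hX (ltnSn n.*2.+1).
rewrite coefX eqSS double_eq0 => <-.
rewrite coefMr.
have cE i : (i < N)%N -> c`_i = if odd i then (i`!%:R)^-1 else 0.
  move=> iN; rewrite /c coefZ coefD coefZ coef_comp_scaleX coef_poly iN.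
  rewrite -signr_odd; case: odd; rewrite ?expr0 ?expr1; field;
    by rewrite pnatr_eq0 -lt0n fact_gt0.
have dE i : (i < N)%N -> d`_i = t_over_sinh_coef B i.
  move=> iN; rewrite /d coefD !coefZ coef_comp_scaleX coef_poly iN.
  by rewrite /t_over_sinh_coef; ring.
rewrite -doubleS (sum_even_odd (fun i => c`_(n.*2.+1 - i) * d`_i)).
apply: eq_bigr => i _; have hi : (i <= n)%N by rewrite -ltnS.
have hd : (i.*2.+1 < N)%N by rewrite ltnS ltnS leq_double.
rewrite !cE ?dE ?(ltnW hd) // ?(leq_ltn_trans (leq_subr _ _)) //.
rewrite subSS -doubleB odd_double subSn ?leq_double // -doubleB oddS odd_double.
by rewrite mul0r addr0 mulrC.
Qed.

(** * The limit of the complete homogeneous sums of 1/j^2 *)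

(** The duality with the elementary symmetric functions expresses h_n through the
    earlier h_i, so convergence and the value of the limit come together by
    induction; the limits satisfy the same recursion by bernoulli_conv. *)
Lemma cvg_hsym_inv_squares (R : realType) (B : nat -> R) n : is_bernoulli B ->
  hsym (inv_powers R 2 N) n @[N --> \oo] -->
    ((-1) ^+ n * t_over_sinh_coef B n.*2 * pi ^+ n.*2 : R).
Proof.
move=> hB; elim/ltn_ind: n => n IH.
pose l i : R := (-1) ^+ i * pi ^+ i.*2 / (i.*2.+1)`!%:R.
pose L i : R := (-1) ^+ i * t_over_sinh_coef B i.*2 * pi ^+ i.*2.
have lL : \sum_(i < n.+1) l i * L (n - i)%N = (n == 0%N)%:R.
  have E (i : 'I_n.+1) : l i * L (n - i)%N = (-1) ^+ n * pi ^+ n.*2 *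
      (t_over_sinh_coef B (n - i).*2 / (i.*2.+1)`!%:R).
    have hi : (i <= n)%N by rewrite -ltnS.
    have -> : (-1) ^+ n * pi ^+ n.*2 =
        (-1) ^+ i * pi ^+ i.*2 * ((-1) ^+ (n - i) * pi ^+ (n - i).*2) :> R.
      by rewrite mulrACA -!exprD -doubleD subnKC.
    by rewrite /l /L; ring.
  rewrite (eq_bigr _ (fun i _ => E i)) -mulr_sumr.
  rewrite (reindex_inj rev_ord_inj) /=.
  rewrite (eq_bigr (fun i : 'I_n.+1 =>
      t_over_sinh_coef B i.*2 / ((n - i).*2.+1)`!%:R)); last first.
    by move=> i _; rewrite subSS subKn // -ltnS.
  rewrite bernoulli_conv //; case: n {IH E} => [|n]; rewrite ?mulr0 //.
  by rewrite mul1r !mulr1 ?expr0 ?mul1r ?mulr1.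
have l0 : l 0%N = 1 by rewrite /l double0 factS fact0 !expr0 !mul1r invr1.
move: lL; rewrite big_ord_recl l0 mul1r subn0 => /(canRL (addrK _)).
rewrite -/(L n) => ->.
have E N : hsym (inv_powers R 2 N) n = (n == 0%N)%:R -
    \sum_(i < n) (recip_prod (inv_powers R 2 N))`_i.+1 *
       hsym (inv_powers R 2 N) (n - i.+1).
  apply/esym/(canLR (addrK _)).
  rewrite -(sum_recip_prod_hsym (inv_powers R 2 N)).
  rewrite big_ord_recl subn0; congr (_ + _).
  have := sum_recip_prod_hsym (inv_powers R 2 N) 0.
  by rewrite big_ord_recl big_ord0 hsym0 addr0 mulr1 => ->; rewrite mul1r.
under eq_fun do rewrite E.
apply: cvgB; first exact: cvg_cst.
apply: (cvg_sum_seq (u := fun (i : 'I_n) N =>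
  (recip_prod (inv_powers R 2 N))`_i.+1 * hsym (inv_powers R 2 N) (n - i.+1))).
move=> i _; apply: cvgM; first exact: cvg_recip_prod_inv_squares.
by apply: IH; rewrite ltn_subrL /= (leq_ltn_trans _ (ltn_ord i)).
Qed.

(** * The star value as a limit of complete homogeneous sums *)

Definition bounded_chains (r N : nat) : set (r.-tuple nat) :=
  [set m | sorted geq m && all (fun x => 0 < x <= N)%N m].
Arguments bounded_chains : clear implicits.

(** A chain with entries at most N + 1 either has all entries at most N or starts
    with N + 1: the recursion that defines [hsym]. *)
Lemma bounded_chainsS r N :
  bounded_chains r.+1 N.+1 =
  bounded_chains r.+1 N `|`
  [set [tuple of N.+1 :: m] | m in bounded_chains r N.+1].
Proof.
apply/seteqP; split=> [m|m].
- case/tupleP: m => x m /= /andP[hs /andP[/andP[x0 xN] hm]].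
  have [xE|xN'] := eqVneq x N.+1.
    right; exists m; last by apply: val_inj; rewrite /= xE.
    by apply/andP; split; [exact: path_sorted hs | exact: hm].
  left; have {xN'}xN : (x <= N)%N by rewrite -ltnS ltn_neqAle xN'.
  apply/andP; split; first exact: hs.
  rewrite /= x0 xN /=.
  have := order_path_min (rev_trans leq_trans) hs.
  move/allP => hx; apply/allP => y ym; have /= yx := hx y ym.
  by have /andP[-> _] := allP hm y ym; rewrite (leq_trans yx).
- case=> [/andP[hs /allP hm]|[m' /andP[hs hm] <-]].
    apply/andP; split; first exact: hs.
    apply/allP => y ym; by have /andP[-> /leqW] := hm y ym.
  apply/andP; split; last by rewrite /= leqnn.
  rewrite /= path_min_sorted //; apply/allP => y ym.
  by have /andP[_] := allP hm y ym.
Qed.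

(** The constant c absorbs the weight of a leading entry in the induction. *)
Lemma esum_bounded_chains (R : realType) (k r N : nat) (c : R) : 0 <= c ->
  \esum_(m in bounded_chains r N)
    (c * \prod_(i < r) ((tnth m i)%:R ^+ k)^-1)%:E =
  (c * hsym (inv_powers R k N) r)%:E.
Proof.
have pos n (m : n.-tuple nat) : 0 <= \prod_(i < n) ((tnth m i)%:R ^+ k)^-1 :> R.
  by apply: prodr_ge0 => i _; rewrite invr_ge0 exprn_ge0.
elim: r N c => [|r IHr] N c c0.
  have -> : bounded_chains 0 N = [set [tuple]].
    by apply/seteqP; split=> m // _; rewrite (tuple0 m).
  rewrite esum_set1 ?lee_fin ?mulr_ge0 // big_ord0 hsym0 //.
elim: N => [|N IHN].
  have -> : bounded_chains r.+1 0 = set0.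
    apply/seteqP; split=> m //; case/tupleP: m => x m /=.
    by rewrite /bounded_chains /= andbC; case: x.
  by rewrite esum_set0 /= mulr0.
rewrite bounded_chainsS inv_powersS hsymS -inv_powersS.
rewrite (esumID (bounded_chains r.+1 N)); last first.
  by move=> m _; rewrite lee_fin mulr_ge0.
have disj : bounded_chains r.+1 N `&`
    [set [tuple of N.+1 :: m] | m in bounded_chains r N.+1] = set0.
  apply/seteqP; split=> m // [+ [m' _ mE]]; rewrite -mE.
  by rewrite /bounded_chains /= ltnn andbF.
have -> : (bounded_chains r.+1 N `|`
    [set [tuple of N.+1 :: m] | m in bounded_chains r N.+1]) `&`
    bounded_chains r.+1 N = bounded_chains r.+1 N.
  by rewrite setIUl setIid [X in _ `|` X]setIC disj setU0.
have -> : (bounded_chains r.+1 N `|`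
    [set [tuple of N.+1 :: m] | m in bounded_chains r N.+1]) `&`
    ~` bounded_chains r.+1 N =
    [set [tuple of N.+1 :: m] | m in bounded_chains r N.+1].
  rewrite setIUl setICr set0U; apply/setIidl => m hm hm'.
  by have : set0 m by rewrite -disj.
rewrite IHN esum_image; last first.
  by move=> m m' _ _ /(congr1 val) [] /val_inj.
rewrite mulrDr EFinD; congr (_ + _)%E.
rewrite mulrA -(IHr N.+1); last by rewrite mulr_ge0 ?invr_ge0 ?exprn_ge0.
apply: eq_esum => m _; congr _%:E; rewrite big_ord_recl -mulrA.
congr (_ * (_ * _)).
by apply: eq_bigr => i _; rewrite tnthS.
Qed.

(** Every finite set of chains is bounded by some N, so the unordered sum is the
    supremum, hence the limit, of the sums over bounded chains. *)
Lemma zeta_star_cvg (R : realType) (k r : nat) (z : R) :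
  hsym (inv_powers R k N) r @[N --> \oo] --> z ->
  zeta_star R [tuple of nseq r k] = z%:E.
Proof.
move=> hz; have hzE : (hsym (inv_powers R k N) r)%:E @[N --> \oo] --> z%:E.
  by apply: cvg_EFin hz; apply: nearW.
pose w (m : r.-tuple nat) : \bar R :=
  (\prod_(i < r) ((tnth m i)%:R ^+ k)^-1)%:E.
have -> : zeta_star R [tuple of nseq r k] =
    \esum_(m in [set m : r.-tuple nat | sorted geq m && all (leq 1) m]) w m.
  apply: eq_esum => m _; congr _%:E; apply: eq_bigr => i _.
  by rewrite (tnth_nth 0%N) nth_nseq ltn_ord.
have wE N : \esum_(m in bounded_chains r N) w m =
    (hsym (inv_powers R k N) r)%:E.
  rewrite -[hsym _ _]mul1r -esum_bounded_chains //.
  by apply: eq_esum => m _; rewrite mul1r.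
apply/eqP; rewrite eq_le; apply/andP; split.
- apply: ge_ereal_sup => _ [A [finA AS] <-].
  have [s sE] := (finite_seqP A).1 finA.
  apply: (cvge_to_ge hzE); near=> N.
  have hN : (\max_(m <- s) \max_(x <- val m) x <= N)%N.
    by near: N; exact: nbhs_infty_ge.
  rewrite -wE; apply: esum_ge; exists A => //; split => // m Am.
  have /andP[hs /allP hm] := AS m Am; apply/andP; split; first exact: hs.
  apply/allP => x xm; rewrite (hm x xm) (leq_trans _ hN) //.
  have ms : m \in s by move: Am; rewrite sE.
  apply: (@leq_trans (\max_(x <- val m) x)).
    exact: (leq_bigmax_seq (F := id) x xm).
  exact: (leq_bigmax_seq
    (F := fun m : r.-tuple nat => \max_(x <- val m) x) m ms).
- apply: (cvge_to_le hzE); apply: nearW => N; rewrite -wE.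
  apply: ereal_sup_le => _ [A [finA AS] <-]; exists A => //; split => // m /AS.
  move=> /andP[hs /allP hm]; apply/andP; split; first exact: hs.
  by apply/allP => x /hm /andP[].
Unshelve. all: by end_near. Qed.

(** * Roots of unity and the final identity *)

(** For 0 < i < m, cos (2 y) = 1 - 2 sin^2 y at y = pi i/m differs from 1 because
    y lies strictly between 0 and pi. *)
Lemma cos_sin_prim_root (R : realType) m : (0 < m)%N ->
  m.-primitive_root (cos (2 * pi / m%:R) +i* sin (2 * pi / m%:R) : R[i]).
Proof.
move=> m0; have mR : m%:R != 0 :> R by rewrite pnatr_eq0 -lt0n.
apply/andP; split => //; apply/forallP => i; rewrite unity_rootE cos_sin_exp.
apply/eqP; have [->|im] := eqVneq i.+1 m.
  have -> : m%:R * (2 * pi / m%:R) = pi *+ 2 :> R by field.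
  rewrite cos2pi sin2pi; exact/eqP.
apply/negbTE/negP => /eqP[hc _].
have {im}im : (i.+1 < m)%N by rewrite ltn_neqAle im ltn_ord.
set x := i.+1%:R * (pi / m%:R : R).
have xE : i.+1%:R * (2 * pi / m%:R) = x *+ 2 :> R.
  by rewrite /x -mulr_natl; ring.
move: hc; rewrite xE cos_mulr2n cos2sin2 => hc.
have : sin x != 0.
  rewrite gt_eqF // sin_gt0_pi // /x mulr_gt0 ?divr_gt0 ?pi_gt0 ?ltr0n //=.
  by rewrite mulrCA gtr_pMr ?pi_gt0 // ltr_pdivrMr ?ltr0n // mul1r ltr_nat.
by rewrite -sqrf_eq0 => /eqP; apply; lra.
Qed.

Lemma cexp_root (R : realType) (m s : nat) : (0 < m)%N ->
  cexp (2 * pi%:C * 'i%C / m%:R * s%:R) =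
  (cos (2 * pi / m%:R) +i* sin (2 * pi / m%:R)) ^+ s :> R[i].
Proof.
move=> m0; rewrite cos_sin_exp.
have -> : 2 * pi%:C * 'i%C / m%:R * s%:R =
    0 +i* (s%:R * (2 * pi / m%:R)) :> R[i].
  have -> : 0 +i* (s%:R * (2 * pi / m%:R)) =
      'i%C * (s%:R * (2 * pi / m%:R))%:C :> R[i].
    by simpc.
  rewrite !rmorphM fmorphV !rmorph_nat; ring.
by rewrite /cexp /= expR0 mul1r.
Qed.

Lemma ReIm_real_mul (R : realType) (x : R) (w : R[i]) :
  complex.Re (x%:C * w) = x * complex.Re w /\
  complex.Im (x%:C * w) = x * complex.Im w.
Proof. by case: w => a b; simpc. Qed.

Lemma hsym_inv_powers_mul (R : realType) (m n N : nat) : (0 < m)%N ->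
  (hsym (inv_powers R (2 * m) N) n)%:C =
  \sum_(f : {ffun 'I_m -> 'I_(m * n).+1} |
          (\sum_(k < m) (f k : nat))%N == (m * n)%N)
     (\prod_(k < m) hsym (inv_powers R 2 N) (f k))%:C *
     (cos (2 * pi / m%:R) +i* sin (2 * pi / m%:R))
       ^+ (\sum_(l < m) (l * f l)%N).
Proof.
move=> m0; rewrite hsym_map.
have -> : map (real_complex R) (inv_powers R (2 * m) N) =
    [seq x ^+ m | x <- map (real_complex R) (inv_powers R 2 N)].
  rewrite -!map_comp; apply: eq_map => j /=.
  by rewrite exprM -exprVn rmorphXn.
rewrite (hsym_pow n _ (cos_sin_prim_root R m0)); apply: eq_bigr => f _.
rewrite big_split rmorph_prod -prodrXr /=; congr (_ * _).
  by apply: eq_bigr => k _; rewrite hsym_map.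
by apply: eq_bigr => k _; rewrite exprM.
Qed.

Theorem theoremA (R : realType) (B : nat -> R) (hB : is_bernoulli B)
    (m n : nat) (hm : (0 < m)%N) (hn : (0 < n)%N) :
  exists2 z : R,
    zeta_star R [tuple of nseq n (2 * m)%N] = z%:E &
    z%:C =
      (\sum_(f : {ffun 'I_m -> 'I_(m * n).+1} |
              (\sum_(k < m) (f k : nat))%N == (m * n)%N)
         (-1) ^+ (m * (n - 1)) *
         (\prod_(k < m)
            (((2 ^+ (2 * f k) - 2) * B (2 * f k)%N) / ((2 * f k)`!)%:R)%:C) *
         cexp (2 * pi%:C * 'i%C / m%:R * (\sum_(l < m) (l * f l)%N%:R)))
      * pi%:C ^+ (2 * m * n).
Proof.
pose w : R[i] := cos (2 * pi / m%:R) +i* sin (2 * pi / m%:R).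
pose W (f : {ffun 'I_m -> 'I_(m * n).+1}) := w ^+ (\sum_(l < m) (l * f l)%N).
pose S := [pred f : {ffun 'I_m -> 'I_(m * n).+1} |
  (\sum_(k < m) (f k : nat))%N == (m * n)%N].
pose L i : R := (-1) ^+ i * t_over_sinh_coef B i.*2 * pi ^+ i.*2.
pose h N (f : {ffun 'I_m -> 'I_(m * n).+1}) :=
  \prod_(k < m) hsym (inv_powers R 2 N) (f k).
(* Real and imaginary parts of the identity for finite N have this form. *)
have cvg_part (p : {ffun 'I_m -> 'I_(m * n).+1} -> R) :
    \sum_(f | S f) h N f * p f @[N --> \oo] -->
      \sum_(f | S f) (\prod_(k < m) L (f k)) * p f.
  apply: (cvg_sum_seq (u := fun f N => h N f * p f)) => f _.
  apply: cvgM; last exact: cvg_cst.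
  apply: (cvg_prod_seq
    (u := fun (k : 'I_m) N => hsym (inv_powers R 2 N) (f k))).
  by move=> k _; apply: cvg_hsym_inv_squares.
have partE N : hsym (inv_powers R (2 * m) N) n =
      \sum_(f | S f) h N f * complex.Re (W f) /\
    0 = \sum_(f | S f) h N f * complex.Im (W f).
  have E := hsym_inv_powers_mul R n N hm; split.
    have := congr1 (@complex.Re R) E; rewrite raddf_sum /= => ->.
    by apply: eq_bigr => f _; apply: (ReIm_real_mul _ _).1.
  have := congr1 (@complex.Im R) E; rewrite raddf_sum /= => E'.
  apply: etrans E' _.
  by apply: eq_bigr => f _; apply: (ReIm_real_mul _ _).2.
have Im0 : \sum_(f | S f) (\prod_(k < m) L (f k)) * complex.Im (W f) = 0.
  have := cvg_part (fun f => complex.Im (W f)).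
  under eq_fun do rewrite -(partE _).2.
  move/cvg_lim => <- //; exact: lim_cst.
exists (\sum_(f | S f) (\prod_(k < m) L (f k)) * complex.Re (W f)).
  apply: zeta_star_cvg; under eq_fun do rewrite (partE _).1.
  exact: (cvg_part (fun f => complex.Re (W f))).
transitivity (\sum_(f | S f) (\prod_(k < m) L (f k))%:C * W f).
  apply/eqP; rewrite eq_complex /= !raddf_sum /=.
  apply/andP; split; apply/eqP.
    by apply: eq_bigr => f _; rewrite (ReIm_real_mul _ _).1.
  rewrite -[LHS]Im0; apply: eq_bigr => f _.
  by rewrite [RHS](ReIm_real_mul _ _).2.
rewrite mulr_suml; apply: eq_bigr => f /eqP hf.
rewrite -natr_sum cexp_root // -/w -/(W f) mulrAC; congr (_ * _).
pose b i : R := (2 ^+ (2 * i) - 2) * B (2 * i)%N / (2 * i)`!%:R.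
have LE i : L i = (-1) ^+ i.+1 * pi ^+ (2 * i) * b i.
  by rewrite /L /b /t_over_sinh_coef mul2n exprS; ring.
(* m n + m and m (n - 1) differ by 2 m. *)
have sgnE : (-1) ^+ (\sum_(k < m) (f k).+1) = (-1) ^+ (m * (n - 1)) :> R.
  under eq_bigr do rewrite -addn1; rewrite big_split /= hf sum1_card card_ord.
  rewrite -[in LHS](prednK hn) -subn1 mulnS addnC addnA !exprD -exprMn.
  by rewrite mulrNN mulr1 expr1n mul1r.
rewrite (eq_bigr _ (fun k _ => LE (f k))) 2!big_split /= !prodrXr sgnE.
rewrite -big_distrr /= hf mulnA -rmorph_prod !rmorphM !rmorphXn rmorphN rmorph1.
by rewrite mulrAC.
Qed.
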